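(* Let $T$ be a distributive lattice. The following properties are equivalent: (i) $T$ contains a subset isomorphic (as a poset) to $[\omega]^{<\omega}$; (ii) the lattice $[\omega]^{<\omega}$ is a quotient (homomorphic image) of some sublattice of $T$; (iii) $T$ contains a sublattice isomorphic to $I_{<\omega}(\Gamma)$ or to $I_{<\omega}(\Delta)$.
   Context: $[\omega]^{<\omega}$ is the set of finite subsets of $\omega$ ordered by inclusion. $\Delta:=\{(i,j): i<j\leq\omega\}$, ordered by $(i,j)\leq(i',j')$ iff either $j\leq i'$, or $i=i'$ and $j\leq j'$. $\Gamma:=\{(i,j)\in\Delta: j=i+1 \text{ or } j=\omega\}$ with the induced order. For a poset $Q$, $I_{<\omega}(Q)$ is the set of finitely generated initial segments (down-closed subsets) of $Q$, including $\emptyset$, ordered by inclusion; $I_{<\omega}(\Gamma)$ and $I_{<\omega}(\Delta)$ are distributive lattices. Sublattices need not preserve a least or a greatest element. *)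

(* Defs.v *)
From HB Require Import structures.
From mathcomp Require Import all_boot all_order finmap.
From mathcomp Require Import boolp classical_sets functions cardinality.
From mathcomp Require Import zify.

Set Implicit Arguments.
Unset Strict Implicit.
Unset Printing Implicit Defensive.

Import Order.TTheory Order.ClosedPredicates.

Section Containment.
Context {d d' : Order.disp_t}.

Definition contains_subposet (P : porderType d') (T : porderType d) : Prop :=
  exists (S : {pred T}) (f : P -> T),
    set_bij [set: P]%classic [set` S]%classic f /\
    {mono f : x y / (x <= y)%O}.

Definition sublattice (T : latticeType d) (S : {pred T}) : Prop :=
  meet_closed S /\ join_closed S.

Definition contains_sublattice (L : latticeType d') (T : latticeType d) : Prop :=
  exists S : {pred T}, sublattice S /\
    exists f : L -> T,
      [/\ set_bij [set: L]%classic [set` S]%classic f,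
          Order.meet_morphism f & Order.join_morphism f].

(* Only the values of [h] on [S] matter. *)
Definition quotient_of_sublattice (L : latticeType d') (T : latticeType d)
    : Prop :=
  exists S : {pred T}, sublattice S /\
    exists h : T -> L,
      [/\ {in S &, {morph h : x y / (x `&` y)%O}},
          {in S &, {morph h : x y / (x `|` y)%O}} &
          set_surj [set` S]%classic [set: L]%classic h].

End Containment.

Section FsetLattice.
Variable K : choiceType.
Implicit Types A B : {fset K}.
Local Open Scope fset_scope.

Let fset_le_def A B : (A `<=` B) = (A `&` B == A).
Proof. by apply/idP/eqP => /fsetIidPl. Qed.

Let fset_lt_def A B : (A `<` B) = (B != A) && (A `<=` B).
Proof. by rewrite fproperEneq eq_sym. Qed.

HB.instance Definition _ :=
  Order.isMeetJoinDistrLattice.Build set_display {fset K}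
    fset_le_def fset_lt_def (@fsetIC K) (@fsetUC K) (@fsetIA K) (@fsetUA K)
    (fun _ _ => fsetKU _ _) (fun _ _ => fsetKI _ _) (@fsetIUl K) (@fsetIid K).

End FsetLattice.

Definition down_closure d (Q : porderType d) (F : set Q) : set Q :=
  [set x | exists2 y, F y & (x <= y)%O]%classic.

Definition fg_initial d (Q : porderType d) (A : set Q) : Prop :=
  exists2 F : set Q, finite_set F & A = down_closure F.

Definition fg_initial_pred d (Q : porderType d) : pred (set Q) :=
  fun A => `[< fg_initial A >].

(* I_{<omega}(Q); it contains [set0], the down-closure of [set0]. *)
Definition finSeg d (Q : porderType d) : Type :=
  {A : set Q | fg_initial_pred A}.

HB.instance Definition _ d (Q : porderType d) :=
  SubChoice.copy (finSeg Q) {A : set Q | fg_initial_pred A}.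
HB.instance Definition _ d (Q : porderType d) :=
  [SubChoice_isSubPOrder of finSeg Q by <: with set_display].

Section FinSegLattice.
Context {d : Order.disp_t} {Q : meetSemilatticeType d}.
Local Open Scope classical_set_scope.

Lemma fg_initial_meet_closed : meet_closed (@fg_initial_pred d Q).
Proof.
move=> A B /asboolP[F finF ->] /asboolP[G finG ->]; apply/asboolP.
exists [set (x `&` y)%O | x in F & y in G]; first exact: finite_image2.
apply/seteqP; split=> x /=.
- case=> -[y Fy xy] [z Gz xz]; exists (y `&` z)%O; last by rewrite lexI xy.
  by exists y => //; exists z.
- case=> _ [y Fy [z Gz <-]]; rewrite lexI => /andP[xy xz].
  by split; [exists y | exists z].
Qed.

Lemma fg_initial_join_closed : join_closed (@fg_initial_pred d Q).
Proof.
move=> A B /asboolP[F finF ->] /asboolP[G finG ->]; apply/asboolP.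
exists (F `|` G); first by rewrite finite_setU.
apply/seteqP; split=> x /=.
- by case=> -[y Fy xy]; exists y => //; [left | right].
- by case=> y [Fy|Gy] xy; [left | right]; exists y.
Qed.

HB.instance Definition _ :=
  @Order.SubPOrder_isSubLattice.Build _ (set Q) (@fg_initial_pred d Q)
    set_display (finSeg Q) fg_initial_meet_closed fg_initial_join_closed.

Lemma val_finSegI (A B : finSeg Q) : val (A `&` B)%O = val A `&` val B.
Proof. by []. Qed.

Lemma val_finSegU (A B : finSeg Q) : val (A `|` B)%O = val A `|` val B.
Proof. by []. Qed.

Lemma le_finSegE (A B : finSeg Q) : (A <= B)%O = `[< val A `<=` val B >].
Proof. by []. Qed.

Let finSeg_meetUl :
  @left_distributive (finSeg Q) (finSeg Q) Order.meet Order.join.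
Proof.
move=> A B C; apply: val_inj.
by rewrite !(val_finSegI, val_finSegU) setIUl.
Qed.

HB.instance Definition _ :=
  Order.Lattice_Meet_isDistrLattice.Build set_display (finSeg Q) finSeg_meetUl.

End FinSegLattice.

(* The ordinal [omega + 1] is encoded as [option nat], [None] being omega. *)
Definition le_omega (j k : option nat) : bool :=
  match j, k with
  | _, None => true
  | None, Some _ => false
  | Some m, Some n => m <= n
  end.

Definition lt_omega (j k : option nat) : bool := ~~ le_omega k j.

(* The first component is a [nat] because [i < j <= omega] makes [i] finite. *)
Definition Delta : Type := {p : nat * option nat | lt_omega (Some p.1) p.2}.

HB.instance Definition _ :=
  SubChoice.copy Delta {p : nat * option nat | lt_omega (Some p.1) p.2}.

Definition le_Delta (x y : Delta) : bool :=
  let: (i, j) := val x in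
  let: (i', j') := val y in
  le_omega j (Some i') || (i == i') && le_omega j j'.

Fact Delta_display : Order.disp_t. Proof. exact: Order.Disp tt tt. Qed.

Fact le_Delta_refl : reflexive le_Delta.
Proof.
by case=> -[i [j|]] /= h; rewrite /le_Delta /= eqxx ?leqnn ?orbT.
Qed.

Fact le_Delta_anti : antisymmetric le_Delta.
Proof.
case=> -[i j] h [[i' j'] h'] le; apply: val_inj; move: h h' le.
rewrite /le_Delta /lt_omega /=.
case: j j' => [j|] [j'|] /= *; do ?[congr (_, Some _)|congr (_, None)]; lia.
Qed.

Fact le_Delta_trans : transitive le_Delta.
Proof.
case=> -[i j] h [[i' j'] h'] [[i'' j''] h'']; move: h h' h''.
by rewrite /le_Delta /lt_omega /=; case: j j' j'' => [j|] [j'|] [j''|] /=; lia.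
Qed.

HB.instance Definition _ := Order.Le_isPOrder.Build Delta_display Delta
  le_Delta_refl le_Delta_anti le_Delta_trans.

Definition min_omega (j k : option nat) : option nat :=
  if le_omega j k then j else k.

Definition meet_Delta_val (p q : nat * option nat) : nat * option nat :=
  if p.1 == q.1 then (p.1, min_omega p.2 q.2)
  else if p.1 < q.1 then (p.1, min_omega p.2 (Some q.1))
  else (q.1, min_omega q.2 (Some p.1)).

Fact meet_Delta_subproof (x y : Delta) :
  let p := meet_Delta_val (val x) (val y) in lt_omega (Some p.1) p.2.
Proof.
case: x y => -[i j] h [[i' j'] h'] /=; move: h h'.
rewrite /meet_Delta_val /min_omega /lt_omega /=.
case: eqP => [<-|/eqP]; last case: ltnP;
  by case: j j' => [j|] [j'|] //=; do ?[case: ifP => //=]; lia.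
Qed.

Definition meet_Delta (x y : Delta) : Delta :=
  exist _ (meet_Delta_val (val x) (val y)) (meet_Delta_subproof x y).

Fact le_meet_Delta (x y z : Delta) :
  (x <= meet_Delta y z)%O = (x <= y)%O && (x <= z)%O.
Proof.
case: x y z => -[i j] h [[i' j'] h'] [[i'' j''] h'']; move: h h' h''.
rewrite /Order.le /= /le_Delta /= /meet_Delta_val /min_omega /lt_omega /=.
case: eqP => [<-|/eqP ne]; last case: ltnP => lt;
  case: j j' j'' => [j|] [j'|] [j''|] //=; do ?[case: ifP => /=]; lia.
Qed.

HB.instance Definition _ :=
  Order.POrder_isMeetSemilattice.Build Delta_display Delta le_meet_Delta.

Definition Gamma_pred : pred Delta :=
  fun x => ((val x).2 == Some (val x).1.+1) || ((val x).2 == None).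

Definition Gamma : Type := {x : Delta | Gamma_pred x}.

HB.instance Definition _ := SubChoice.copy Gamma {x : Delta | Gamma_pred x}.
HB.instance Definition _ :=
  [SubChoice_isSubPOrder of Gamma by <: with Delta_display].

Fact lt_omega_succ (i : nat) : lt_omega (Some i) (Some i.+1).
Proof. by rewrite /lt_omega /= ltnn. Qed.

Definition Delta_succ (i : nat) : Delta :=
  exist _ (i, Some i.+1) (lt_omega_succ i).

Fact Gamma_succ_subproof (i : nat) : Gamma_pred (Delta_succ i).
Proof. by rewrite /Gamma_pred /= eqxx. Qed.

Definition Gamma_succ (i : nat) : Gamma :=
  exist _ (Delta_succ i) (Gamma_succ_subproof i).

(* Not the restriction of [meet_Delta]: for [i < i'], the meet of [(i, omega)]
   and [(i', j')] is [(i, i')] in [Delta] but [(i, i + 1)] in [Gamma]. *)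
Definition meet_Gamma (x y : Gamma) : Gamma :=
  let: (i, j) := val (val x) in
  let: (i', j') := val (val y) in
  if i == i' then (if le_omega j j' then x else y)
  else Gamma_succ (minn i i').

Fact le_GammaE (x y : Gamma) : (x <= y)%O = le_Delta (val x) (val y).
Proof. by []. Qed.

Fact le_meet_Gamma (x y z : Gamma) :
  (x <= meet_Gamma y z)%O = (x <= y)%O && (x <= z)%O.
Proof.
rewrite !le_GammaE.
case: x y z => [[[i j] h] g] [[[i' j'] h'] g'] [[[i'' j''] h''] g''].
rewrite /meet_Gamma /=; move: (h) (h') (h'') (g) (g') (g'').
rewrite /Gamma_pred /lt_omega /=.
have SomeN k : (Some k == None :> option nat) = false by [].
case: (eqVneq i' i'') => [<-|ne].
  case le: (le_omega j' j''); rewrite /le_Delta /=; move: le;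
    case: j j' j'' {h h' h'' g g' g''} => [j|] [j'|] [j''|] //=;
    rewrite ?(inj_eq Some_inj) ?SomeN ?orbF; lia.
rewrite /le_Delta /=.
case: j j' j'' {h h' h'' g g' g''} => [j|] [j'|] [j''|] //=;
  rewrite ?(inj_eq Some_inj) ?SomeN ?orbF; lia.
Qed.

HB.instance Definition _ :=
  Order.POrder_isMeetSemilattice.Build Delta_display Gamma le_meet_Gamma.

(* Main.v *)
Require Import Defs.
From mathcomp Require Import all_boot all_order finmap.
From mathcomp Require Import boolp classical_sets functions cardinality.
From mathcomp Require Import zify.

(** An embedding [f] of the finite subsets of omega yields independent elements
    [f {i}]: none lies in the ideal [J_i] generated by the [f G] with
    [i \notin G].  Calling [s] decided at [i] when, modulo [J_i], it is above or
    disjoint from [f {i}], the elements decided everywhere and above finitely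
    many [f {i}] form a sublattice with quotient the finite subsets of omega.

    From such a quotient, adding to the [n]-th element the meets of the earlier
    ones gives a sequence with [y i `&` y j <= y k] for [i < j < k], so that
    [(i, j) |-> y i `&` y j], [(i, omega) |-> y i] preserves meets on Delta.
    For each [i] the chain [j |-> y i `&` y j] is eventually constant or not;
    on a subsequence, either all these chains are constant, whence Gamma, or all
    are strictly increasing, whence Delta.  Injectivity on segments comes from
    ideals pulled back along the quotient map: [y n] is chosen with image the
    spike [{2n+1} `|` {0, 2, ..., 2n}], where [2n+1] keeps the [y n] independent
    and [2n] separates [y n `&` y m], [n < m], from the join of the earlier
    terms. *)

Set Implicit Arguments.
Unset Strict Implicit.
Unset Printing Implicit Defensive.

Import Order.TTheory.

(** * Order embeddings and antichains *)

Section Embeddings.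
Context {d d' d'' : Order.disp_t}.

Lemma mono_contains_subposet (P : porderType d') (T : porderType d)
    (f : P -> T) :
  {mono f : x y / (x <= y)%O} -> contains_subposet P T.
Proof.
move=> fmono; exists (fun t => `[< exists x, f x = t >]), f; split=> //; split.
- by move=> x _; apply/asboolP; exists x.
- by move=> x y _ _; apply: inc_inj.
- by move=> t /asboolP[x <-]; exists x.
Qed.

(** The order is definable from meets, so an injective meet-preserving map reflects it. *)
Lemma contains_subposet_sublattice (P : porderType d') (L : latticeType d'')
    (T : latticeType d) :
  contains_subposet P L -> contains_sublattice L T -> contains_subposet P T.
Proof.
move=> [_ [f [_ fmono]]] [_ [_ [g [[_ ginj _] gmeet _]]]].
apply: (@mono_contains_subposet _ _ (g \o f)) => x y /=.
by rewrite leEmeet -gmeet (inj_eq (in2TT ginj)) -leEmeet fmono.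
Qed.

End Embeddings.

(** A finite index set goes to the segment generated by its [a i]; in an antichain, no other [a j]
    falls into that segment. *)
Lemma antichain_finSeg d (Q : porderType d) (a : nat -> Q) :
  (forall i j, (a i <= a j)%O -> i = j) ->
  contains_subposet {fset nat} (finSeg Q).
Proof.
move=> anti.
pose down (F : {fset nat}) := down_closure [set a i | i in [set` F]]%classic.
have downP F : fg_initial_pred (down F).
  apply/asboolP; exists [set a i | i in [set` F]]%classic => //.
  exact/finite_image/finite_fset.
pose f F : finSeg Q := exist _ (down F) (downP F).
apply: (@mono_contains_subposet _ _ _ _ f) => F G.
apply/asboolP/fsubsetP => /= [sub i iF | sub x [_ [i iF <-]] xi].
  have [|_ [j jG <-] /anti ->] // := sub (a i).
  by exists (a i) => //; exists i.
by exists (a i) => //; exists i => //; apply: sub.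
Qed.

(** * A criterion for embedding a lattice of segments *)

Section FinSegEmbedding.
Context {d d' : Order.disp_t} (Q : meetSemilatticeType d').
Context (T : distrLatticeType d) (b : T) (z : Q -> T).

Let join_over (s : seq Q) : T := foldr (fun q t => (z q `|` t)%O) b s.

Let le_join_over s q : q \in s -> (z q <= join_over s)%O.
Proof.
elim: s => //= r s IHs; rewrite inE => /orP[/eqP->|/IHs]; first exact: leUl.
exact: lexUr.
Qed.

Let bot_join_over s : (b <= join_over s)%O.
Proof. by elim: s => //= r s; apply: lexUr. Qed.

Let join_over_meet_le s t u :
  (b `&` t <= u)%O -> (forall q, q \in s -> (z q `&` t <= u)%O) ->
  (join_over s `&` t <= u)%O.
Proof.
move=> bu; elim: s => //= r s IHs zu; rewrite meetUl leUx zu ?mem_head //=.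
by apply: IHs => q qs; apply: zu; rewrite inE qs orbT.
Qed.

Let join_over_le s u :
  (b <= u)%O -> (forall q, q \in s -> (z q <= u)%O) -> (join_over s <= u)%O.
Proof.
move=> bu zu; rewrite -[join_over s]meetxx; apply: join_over_meet_le => [|q qs].
  exact: leIxl.
exact/leIxl/zu.
Qed.

(* A finitely generated segment goes to the join of [b] and of the images of
   its elements; the map is injective because the ideal [J] attached to [p]
   contains the images of all segments omitting [p]. *)
Lemma contains_finSeg :
  {morph z : p q / (p `&` q)%O} -> (forall p, (b <= z p)%O) ->
  (forall p, exists J : T -> Prop,
    [/\ forall u v, J u -> J v -> J (u `|` v)%O, J b,
        forall q, ~~ (p <= q)%O -> J (z q)
      & forall u, J u -> ~~ (z p <= u)%O]) ->
  contains_sublattice (finSeg Q) T.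
Proof.
move=> zI bz sep.
have zmono p q : (p <= q)%O -> (z p <= z q)%O.
  by rewrite !leEmeet -zI => /eqP ->.
have genP (A : finSeg Q) : exists s : seq Q,
    forall x, val A x <-> exists2 y, y \in s & (x <= y)%O.
  case: A => A /= /asboolP[F /finite_seqP[s ->] ->].
  by exists s => x; split=> -[y ys xy]; exists y.
have [gen genE] := choice genP.
pose phi A := join_over (gen A).
have le_phi (A : finSeg Q) q : val A q -> (z q <= phi A)%O.
  by move=> /genE[y ys /zmono/le_trans->] //; apply: le_join_over.
have gen_in (A : finSeg Q) q : q \in gen A -> val A q.
  by move=> qA; apply/genE; exists q.
have phi_le (A : finSeg Q) u :
    (b <= u)%O -> (forall q, val A q -> (z q <= u)%O) -> (phi A <= u)%O.
  by move=> bu zu; apply: join_over_le => // q /gen_in /zu.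
have phi_mono (A B : finSeg Q) :
    (val A `<=` val B)%classic -> (phi A <= phi B)%O.
  move=> AB; apply: phi_le => [|q /AB]; first exact: bot_join_over.
  exact: le_phi.
have phiI : Order.meet_morphism phi.
  move=> A B; apply/le_anti/andP; split.
    by rewrite lexI !phi_mono // => x [].
  (* Distributivity expands both joins into meets of [z p] and [z q]; such a meet is the image of
     the meet of [p] and [q], which lies in both segments. *)
  apply: join_over_meet_le => [|p /gen_in pA].
    exact/leIxl/bot_join_over.
  rewrite meetC; apply: join_over_meet_le => [|q /gen_in qB].
    exact/leIxl/bot_join_over.
  rewrite -zI; apply: le_phi; split.
    move: pA => /genE[y ys py]; apply/genE; exists y => //.
    exact: leIxr.
  move: qB => /genE[y ys qy]; apply/genE; exists y => //.
  exact: leIxl.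
have phiU : Order.join_morphism phi.
  move=> A B; apply/le_anti/andP; split; last first.
    rewrite leUx; apply/andP.
    by split; apply: phi_mono => x; [left | right].
  apply: phi_le => [|q [/le_phi qA|/le_phi qB]].
  - exact/lexUl/bot_join_over.
  - exact: lexUl.
  - exact: lexUr.
have phi_sub A B : phi A = phi B -> (val A `<=` val B)%classic.
  move=> AB q qA; apply: contrapT => qB.
  have [J [JU Jb Jz /(_ (phi B))]] := sep q.
  rewrite -{2}AB le_phi // => Jnot; suff /Jnot : J (phi B) by [].
  have: forall p, p \in gen B -> J (z p).
    move=> p pB; apply: Jz; apply/negP => qp; apply: qB.
    by apply/genE; exists p.
  rewrite /phi; elim: (gen B) => //= r s IHs Js.
  apply: JU; first exact/Js/mem_head.
  by apply: IHs => p ps; apply: Js; rewrite inE ps orbT.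
exists (fun t => `[< exists A, phi A = t >]); split.
  split=> _ _ /asboolP[A <-] /asboolP[B <-]; apply/asboolP.
  - by exists (A `&` B)%O.
  - by exists (A `|` B)%O.
exists phi; split=> //; split.
- by move=> A _; apply/asboolP; exists A.
- by move=> A B _ _ AB; apply/val_inj/seteqP; split; apply: phi_sub.
- by move=> t /asboolP[A <-]; exists A.
Qed.

End FinSegEmbedding.

(** * From a subposet to a quotient *)

Section Quotient.
Context {d : Order.disp_t} (T : distrLatticeType d) (f : {fset nat} -> T).
Hypothesis fmono : {mono f : F G / (F <= G)%O}.
Local Open Scope fset_scope.

(* Modulo the ideal generated by the [f G] with [i \notin G], the element [s]
   is above, resp. disjoint from, the image of [i]. *)
Let above (i : nat) s :=
  exists2 G : {fset nat}, i \notin G & (f [fset i] <= s `|` f G)%O.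
Let apart (i : nat) s :=
  exists2 G : {fset nat}, i \notin G & (s `&` f [fset i] <= f G)%O.

Let trace_of s (F : {fset nat}) :=
  forall i : nat, if i \in F then above i s else apart i s.

Let fU F G : (f F `|` f G <= f (F `|` G)%fset)%O.
Proof.
rewrite leUx !fmono; apply/andP.
by split; [apply: fsubsetUl | apply: fsubsetUr].
Qed.

(** With witnesses [G] and [H], distributivity would put [f [fset i]] below the image of their
    union, although [i] is in neither. *)
Let above_apart i s : above i s -> apart i s -> False.
Proof.
move=> [G iG is_le] [H iH si_le].
suff: (f [fset i] <= f (G `|` H)%fset)%O.
  rewrite fmono => /fsubsetP/(_ i).
  by rewrite !inE eqxx (negPf iG) (negPf iH) => /(_ isT).
apply: le_trans (fU _ _); rewrite joinC -[leLHS](meet_idPr is_le) meetUl.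
by apply: leU2 => //; apply: leIl.
Qed.

Let trace_uniq s F G : trace_of s F -> trace_of s G -> F = G.
Proof.
move=> sF sG; apply/fsetP => i; move: (sF i) (sG i).
by case: ifP => _; case: ifP => _ // ? ?; exfalso; apply: (@above_apart i s).
Qed.

Let trace_join s t F G :
  trace_of s F -> trace_of t G -> trace_of (s `|` t)%O (F `|` G).
Proof.
move=> sF tG i; move: (sF i) (tG i); rewrite in_fsetU.
case: ifP => _ /=; first by case=> H iH le _; exists H; rewrite // joinAC lexUl.
case: ifP => _ /=; first by move=> _ [H iH le]; exists H;
  rewrite // -joinA lexUr.
move=> [H iH leH] [K iK leK]; exists (H `|` K).
  by rewrite in_fsetU negb_or iH.
by rewrite meetUl; apply: le_trans (fU _ _); apply: leU2.
Qed.

Let trace_meet s t F G :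
  trace_of s F -> trace_of t G -> trace_of (s `&` t)%O (F `&` G).
Proof.
move=> sF tG i; move: (sF i) (tG i); rewrite in_fsetI.
case: ifP => _ /=; last first.
  by case=> H iH le _; exists H => //; rewrite meetAC; apply: leIxl.
case: ifP => _ /=; last first.
  by move=> _ [H iH le]; exists H => //; rewrite -meetA; apply: leIxr.
move=> [H iH leH] [K iK leK]; exists (H `|` K).
  by rewrite in_fsetU negb_or iH.
rewrite joinIl lexI; apply/andP; split.
  apply: le_trans leH _; apply: leU2 => //.
  by apply: le_trans (fU _ _); apply: leUl.
apply: le_trans leK _; apply: leU2 => //.
by apply: le_trans (fU _ _); apply: leUr.
Qed.

Let trace_f F : trace_of (f F) F.
Proof.
move=> i; case: ifP => iF; last by exists F; rewrite ?iF //; apply: leIl.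
exists fset0 => //; apply: lexUl; rewrite fmono; apply/fsubsetP => j.
by rewrite inE => /eqP->.
Qed.

Lemma fset_quotient : quotient_of_sublattice {fset nat} T.
Proof.
(* Elements without a finite trace get the default [fset0]; they lie outside the sublattice. *)
have hP s : exists F : {fset nat}, (exists G, trace_of s G) -> trace_of s F.
  case: (pselect (exists G, trace_of s G)) => [[G sG]|no]; last by exists fset0.
  by exists G.
have [h hE] := choice hP.
have hF s F : trace_of s F -> h s = F.
  by move=> sF; apply: (@trace_uniq s) => //; apply: hE; exists F.
exists (fun s => `[< exists F, trace_of s F >]); split.
  split=> s t /asboolP[F sF] /asboolP[G tG]; apply/asboolP.
  - by exists (F `&` G); apply: trace_meet.
  - by exists (F `|` G); apply: trace_join.
exists h; split=> [s t|s t|F _].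
- move=> /asboolP[F sF] /asboolP[G tG].
  by rewrite (hF _ _ sF) (hF _ _ tG); apply/hF/trace_meet.
- move=> /asboolP[F sF] /asboolP[G tG].
  by rewrite (hF _ _ sF) (hF _ _ tG); apply/hF/trace_join.
- by exists (f F); [apply/asboolP; exists F | apply: hF].
Qed.

End Quotient.

(** * Diagonal subsequences and staircases *)

Lemma diagonal_subsequence (I : nat -> Prop) (R : nat -> nat -> nat -> Prop) :
  (forall N, exists2 m, I m & N <= m) ->
  (forall i l, I i -> exists N, forall m, N <= m -> R i l m) ->
  exists n : nat -> nat,
    [/\ {homo n : i j / i < j}, forall k, I (n k)
      & forall i k, i <= k -> R (n i) (n k) (n k.+1)].
Proof.
move=> Iinf ev.
(* The next index faces finitely many demands, one for each [i <= l] in [I], and each holds from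
   some point on. *)
have nextP l : exists m, [/\ I m, l < m & forall i, i <= l -> I i -> R i l m].
  have [N NP] : exists N, forall m, N <= m ->
      forall i, i < l.+1 -> I i -> R i l m.
    elim: l.+1 => [|k [N NP]]; first by exists 0.
    have [Ik|nIk] := pselect (I k); last first.
      exists N => m Nm i; rewrite ltnS leq_eqVlt => /orP[/eqP->//|].
      exact: NP.
    have [M MP] := ev k l Ik; exists (maxn N M) => m.
    rewrite geq_max => /andP[Nm Mm] i; rewrite ltnS leq_eqVlt.
    by move=> /orP[/eqP-> _|ik]; [apply: MP | apply: NP].
  have [m Im le_m] := Iinf (maxn N l.+1).
  by exists m; split=> // [|i il]; [|apply: NP]; lia.
have [g gP] := choice nextP; have [m0 Im0 _] := Iinf 0.
pose n k := iter k g m0.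
have nI k : I (n k) by case: k => [|k] //=; have [] := gP (n k).
have nmono : {homo n : i j / i < j}.
  by apply: homo_ltn => [|k]; [exact: ltn_trans | have [] := gP (n k)].
exists n; split=> // i k ik; have [_ _ /(_ (n i))] := gP (n k); apply=> //.
by rewrite (ltnW_homo nmono).
Qed.

Lemma le_DeltaE (p q : Delta) : (p <= q)%O = le_Delta p q.
Proof. by []. Qed.

Section Staircase.
Context {d : Order.disp_t} (T : distrLatticeType d).
Implicit Types (b : T) (y : nat -> T).

Definition ideal (J : T -> Prop) : Prop :=
  (forall u v, J u -> J v -> J (u `|` v)%O) /\
  (forall u v, (u <= v)%O -> J v -> J u).

(* Every clause is inherited by subsequences; this is why the separation of the
   [y i] is expressed by ideals. *)
Record staircase b y : Prop := Staircase {
  staircase_bot : forall i, (b <= y i)%O;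
  staircase_meet : forall i j k, i < j < k -> (y i `&` y j <= y k)%O;
  staircase_even : forall i, exists J, [/\ ideal J, J b,
    forall k, k < i -> J (y k) & forall j, i < j -> ~ J (y i `&` y j)%O];
  staircase_odd : forall i, exists J, [/\ ideal J, J b,
    forall k, k != i -> J (y k) & ~ J (y i)] }.

Lemma staircase_subseq b y n :
  staircase b y -> {homo n : i j / i < j} -> staircase b (y \o n).
Proof.
move=> [yb yI ye yo] nmono; split=> [i|i j k /andP[ij jk]|i|i] /=.
- exact: yb.
- by apply: yI; rewrite !nmono.
- have [J [Jid Jb Jlt nJ]] := ye (n i); exists J; split=> // [k ki|j ij].
  + by apply: Jlt; apply: nmono.
  + by apply: nJ; apply: nmono.
- have [J [Jid Jb Jne nJ]] := yo (n i); exists J; split=> // k ki.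
  apply: Jne; move: ki; case: (ltngtP k i) => // /nmono; lia.
Qed.

Lemma staircase_meet_mono b y i j k :
  staircase b y -> i < j <= k -> (y i `&` y j <= y i `&` y k)%O.
Proof.
move=> yst /andP[ij]; rewrite leq_eqVlt => /orP[/eqP->//|jk].
by rewrite lexI leIl (staircase_meet yst) // ij.
Qed.

Lemma staircase_dichotomy b y : staircase b y ->
  exists2 n : nat -> nat, {homo n : i j / i < j} &
    (forall i j, i < j ->
       ~~ (y (n i) `&` y (n j.+1) <= y (n i) `&` y (n j))%O) \/
    (forall i j, i < j -> (y (n i) `&` y (n j) = y (n i) `&` y (n i.+1))%O).
Proof.
move=> yst; have ymono := staircase_meet_mono yst.
(* The chain of meets of [y i] with later terms never stabilises. Either infinitely many [i] are of
   this kind, or none from some [N] on. *)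
pose grows i := forall l, i < l -> exists2 m, l <= m &
  ~~ (y i `&` y m <= y i `&` y l)%O.
have [inf|fin] := pselect (forall N, exists2 m, grows m & N <= m).
  pose R i l m := i < l -> ~~ (y i `&` y m <= y i `&` y l)%O.
  have [|n [nmono _ nR]] := diagonal_subsequence (R := R) inf.
    move=> i l /(_ l); case: (ltnP i l) => [il|li _]; last first.
      by exists 0 => m _; rewrite /R ltnNge li.
    move=> /(_ isT)[m lm nle]; exists m => k mk _.
    by apply: contra nle; apply: le_trans; apply: ymono; lia.
  by exists n => //; left=> i j ij; apply: nR; [apply: ltnW | apply: nmono].
have [N NP] : exists N, forall m, N <= m -> ~ grows m.
  apply: contrapT => no; apply: fin => N; apply: contrapT => no'.
  by apply: no; exists N => m Nm gm; apply: no'; exists m.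
(* Here [m] is past the point where the chain of [i] stabilises; using it at [l = i] makes the
   thinned chain constant from its first term. *)
pose R i (l : nat) m := i < m /\
  forall k, m <= k -> (y i `&` y k = y i `&` y m)%O.
have [|i l Ni|n [nmono nI nR]] := diagonal_subsequence (I := leq N) (R := R).
- by move=> M; exists (maxn M N); rewrite ?leq_maxl ?leq_maxr.
- have [M iM MP] : exists2 M, i < M & forall k, M <= k ->
      (y i `&` y k <= y i `&` y M)%O.
    apply: contrapT => no; apply: (NP i Ni) => M iM.
    apply: contrapT => no'; apply: no; exists M => // k Mk.
    by apply: contrapT => /negP nle; apply: no'; exists k.
  exists M => m Mm; split=> [|k mk]; first exact: leq_trans Mm.
  apply/le_anti; rewrite [X in _ && X]ymono ?mk ?(leq_trans iM) // andbT.
  apply: le_trans (MP k _) _; first exact: leq_trans mk.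
  by apply: ymono; rewrite iM.
exists n => //; right=> i j ij; have [_] := nR i i (leqnn i); apply.
by rewrite (ltnW_homo nmono).
Qed.

(** * Maps from [Delta] and [Gamma] given by a staircase *)

Section Cells.
Variables (b : T) (y : nat -> T).
Hypothesis yst : staircase b y.

Let cell (p : Delta) : T :=
  if (val p).2 is Some j then (y (val p).1 `&` y j)%O else y (val p).1.

Let cell_le p : (cell p <= y (val p).1)%O.
Proof. by rewrite /cell; case: (val p).2 => // j; apply: leIl. Qed.

Let cell_bot p : (b <= cell p)%O.
Proof.
by rewrite /cell; case: (val p).2 => [j|]; rewrite ?lexI !(staircase_bot yst).
Qed.

Let le_meet_y i j k : i < j -> (k == i) || (j <= k) -> (y i `&` y j <= y k)%O.
Proof.
move=> ij /predU1P[->|]; first exact: leIl.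
rewrite leq_eqVlt => /predU1P[<-|jk]; first exact: leIr.
by apply: (staircase_meet yst); rewrite ij.
Qed.

Let cell_mono p q : (p <= q)%O -> (cell p <= cell q)%O.
Proof.
rewrite le_DeltaE.
case: p q => -[i [j|]] ij [[i' [j'|]] ij'];
  move: (ij) (ij'); rewrite /le_Delta /lt_omega /cell /= => hj hj' pq;
  rewrite ?lexI ?le_meet_y ?andbT //; try lia.
by case/andP: pq => /eqP->.
Qed.

(** A [q] not above [(i, omega)] has its cell below some [y k] with [k != i], so the odd ideal of
    [i] serves. *)
Let separate_omega (p : Delta) : (val p).2 = None ->
  exists J : T -> Prop,
    [/\ forall u v, J u -> J v -> J (u `|` v)%O, J b,
        forall q : Delta, ~~ (p <= q)%O -> J (cell q)
      & forall u, J u -> ~~ (cell p <= u)%O].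
Proof.
case: p => -[i j] /= ij j0; rewrite {}j0 {j} in ij *.
have [J [[JU Jle] Jb Jne nJ]] := staircase_odd yst i.
exists J; split=> // [q pq|u Ju]; last first.
  by apply/negP => /Jle/(_ Ju).
have [qi|/Jne] := eqVneq (val q).1 i; last exact/Jle/cell_le.
case: q => -[i' [k|]] ik /= in pq qi *; subst i'; 
    last by move: pq; rewrite le_DeltaE /le_Delta /= eqxx.
rewrite /cell /= meetC; apply: Jle (leIl _ _) (Jne k _).
by move: (ik); rewrite /lt_omega /= -ltnNge; lia.
Qed.

(** The points not above [(i, i+1)] are those with first coordinate below [i], so the even ideal of
    [i] serves. *)
Let separate_succ (p : Delta) : (val p).2 = Some (val p).1.+1 ->
  exists J : T -> Prop,
    [/\ forall u v, J u -> J v -> J (u `|` v)%O, J b,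
        forall q : Delta, ~~ (p <= q)%O -> J (cell q)
      & forall u, J u -> ~~ (cell p <= u)%O].
Proof.
case: p => -[i j] /= ij j1; rewrite {}j1 {j} in ij *.
have [J [[JU Jle] Jb Jlt nJ]] := staircase_even yst i.
exists J; split=> // [q pq|u Ju]; last first.
  by apply/negP => /Jle/(_ Ju); apply: nJ.
apply: (Jle _ _ (cell_le q)); apply: Jlt.
move: pq; rewrite le_DeltaE.
case: q => -[i' [k|]] /=; rewrite /le_Delta /lt_omega /=; lia.
Qed.

Lemma staircase_Delta :
  (forall i j, i < j -> ~~ (y i `&` y j.+1 <= y i `&` y j)%O) ->
  contains_sublattice (finSeg Delta) T.
Proof.
move=> strict; apply: (@contains_finSeg _ _ _ _ b cell) => // [p q|p].
  apply/le_anti; rewrite lexI !cell_mono ?leIl ?leIr //=.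
  have -> : cell (p `&` q)%O = if (val p).1 == (val q).1 then
      (if le_omega (val p).2 (val q).2 then cell p else cell q) else
      if (val p).1 < (val q).1 then
        (if le_omega (val p).2 (Some (val q).1) then cell p
         else (y (val p).1 `&` y (val q).1)%O)
      else
        (if le_omega (val q).2 (Some (val p).1) then cell q
         else (y (val q).1 `&` y (val p).1)%O).
    case: p q => -[i j] ij [[i' j'] ij'].
    rewrite /cell /= /meet_Delta_val /min_omega /=.
    by case: eqP => [->|_] /=; do ?case: ifP.
  case: ifP => _; first by case: ifP; rewrite ?leIl ?leIr.
  case: ifP => _; case: ifP => _; rewrite ?leIl ?leIr //.
    by apply: leI2; apply: cell_le.
  by rewrite meetC; apply: leI2; apply: cell_le.
case pE: (val p).2 => [j|]; last exact: separate_omega.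
have [jE|ji] := eqVneq j (val p).1.+1.
  by apply: separate_succ; rewrite pE jE.
case: p pE ji => -[i j'] ij /= j'E ji; subst j'.
have : i.+1 < j by move: (ij) ji; rewrite /lt_omega /=; lia.
case: j {ji} ij => // j ij; rewrite ltnS => lt_ij.
(* Remaining case [p = (i, j+1)] with [i < j]. Strictness keeps [cell p] out of this ideal. A [q]
   not above [p] starts at some [i' <= j]; if [i' = i], it ends by [j], and otherwise the meet of
   [y i] and [y i'] is already below [y j]. *)
exists (fun u => (y i `&` y j.+1 `&` u <= y i `&` y j)%O); split.
- by move=> u v Ju Jv; rewrite meetUr leUx Ju.
- by apply: leIxr; rewrite lexI !(staircase_bot yst).
- case=> -[i' k] ik; rewrite le_DeltaE /le_Delta /= => pq.
  have [ii|ii|ii] := ltngtP i' i.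
  + apply: (@le_trans _ _ (y i' `&` y i)%O).
      by rewrite meetC; apply: leI2; [apply: cell_le | apply: leIl].
    by rewrite lexI !le_meet_y ?eqxx //; lia.
  + apply: (@le_trans _ _ (y i `&` y i')%O).
      by apply: leI2; [apply: leIl | apply: cell_le].
    by apply: (staircase_meet_mono yst); lia.
  + subst i'; case: k ik pq => [k|] ik pq; last by rewrite eqxx orbT in pq.
    apply: leIxr; apply: (staircase_meet_mono yst).
    by move: (ik) pq; rewrite /lt_omega /=; lia.
- move=> u Ju; apply: contra (strict i j lt_ij) => /meet_idPl pu.
  by rewrite /cell /= in pu; rewrite pu in Ju.
Qed.

Lemma staircase_Gamma :
  (forall i j, i < j -> (y i `&` y j = y i `&` y i.+1)%O) ->
  contains_sublattice (finSeg Gamma) T.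
Proof.
move=> const.
(* Points of [Gamma] with distinct first coordinates meet in [(m, m+1)], [m] the smaller one;
   constancy makes its cell large enough. *)
have constC i j : i != j -> (y i `&` y j <= y (minn i j) `&` y (minn i j).+1)%O.
  by case: ltngtP => // lt _; [|rewrite meetC]; rewrite const.
pose cellG (p : Gamma) := cell (val p).
apply: (@contains_finSeg _ _ _ _ b cellG) => [p q|p|p]; rewrite {}/cellG.
- apply/le_anti; rewrite lexI.
  have GD (r s : Gamma) : (r <= s)%O -> (val r <= val s)%O by [].
  rewrite !cell_mono; [|exact/GD/leIr|exact/GD/leIl].
  rewrite (_ : (p `&` q)%O = meet_Gamma p q) // /meet_Gamma.
  case: p q => -[[i j] ij pG] [[[i' j'] ij'] qG] /=.
  case: eqVneq => [_|ne]; first by case: ifP; rewrite ?leIl ?leIr.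
  by apply: le_trans (constC _ _ ne); apply: leI2; apply: cell_le.
- exact: cell_bot.
- case: (orP (valP p)) => /eqP; [move=> /separate_succ|move=> /separate_omega];
    by move=> [J [JU Jb Jz nJ]]; exists J; split=> // q; apply: Jz.
Qed.

End Cells.

End Staircase.

(** * A staircase from a quotient *)

Section SpikedSequence.
Context {d : Order.disp_t} (T : latticeType d) (x : nat -> T) (b : T).

Fixpoint partial_join n : T :=
  if n is k.+1 then (partial_join k `|` x k)%O else b.

(** In a distributive lattice this is the join of [b] and all meets of [x i] and [x j] with
    [i < j < n]. *)
Fixpoint cumulated_meet n : T :=
  if n is k.+1 then (cumulated_meet k `|` (x k `&` partial_join k))%O else b.

Definition spiked n : T := (x n `|` cumulated_meet n)%O.

Lemma le_partial_join i n : i < n -> (x i <= partial_join n)%O.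
Proof.
elim: n => // n IHn; rewrite ltnS leq_eqVlt => /predU1P[->|/IHn le_in] /=.
  exact: leUr.
exact: lexUl.
Qed.

Lemma cumulated_meet_mono : {homo cumulated_meet : m n / m <= n >-> (m <= n)%O}.
Proof. by apply: homo_leq => [//|???|n]; [apply: le_trans | apply: leUl]. Qed.

Lemma bot_spiked n : (b <= spiked n)%O.
Proof. exact/lexUr/(@cumulated_meet_mono 0). Qed.

End SpikedSequence.

(** The meet of [x i] and [x j] is absorbed into [cumulated_meet] at stage [j.+1], hence by stage
    [k]. *)
Lemma spiked_meet d (T : distrLatticeType d) (x : nat -> T) b i j k :
  i < j < k -> (spiked x b i `&` spiked x b j <= spiked x b k)%O.
Proof.
move=> /andP[ij jk]; apply: lexUr.
apply: le_trans (cumulated_meet_mono _ _ jk) => /=; rewrite meetUl leUx.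
apply/andP; split; last first.
  by apply/leIxl/lexUl/cumulated_meet_mono/ltnW.
rewrite meetUr leUx; apply/andP; split; last exact/leIxr/leUl.
by apply/lexUr; rewrite meetC; apply: leI2 => //; apply: le_partial_join.
Qed.

(** The number [2n+1] belongs to the spike of [n] alone, and [2n] to the spikes of all [m >= n]. *)
Definition spike (n : nat) : {fset nat} :=
  seq_fset tt [seq k <- iota 0 n.*2.+2 | (k == n.*2.+1) || ~~ odd k].

Lemma in_spike n k :
  (k \in spike n) = (k == n.*2.+1) || (k <= n.*2) && ~~ odd k.
Proof. by rewrite seq_fsetE mem_filter mem_iota; lia. Qed.

Lemma quotient_staircase d (T : distrLatticeType d) :
  quotient_of_sublattice {fset nat} T ->
  exists (b : T) (y : nat -> T), staircase b y.
Proof.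
move=> [S [[SI SU] [h [hI hU hsurj]]]].
have preimP (F : {fset nat}) : exists s, s \in S /\ h s = F.
  by have [s sS <-] := hsurj F Logic.I; exists s.
have [g gP] := choice preimP.
pose x n := g (spike n); pose b := g fset0; exists b, (spiked x b).
have bS : b \in S by have [] := gP fset0.
have xS n : x n \in S by have [] := gP (spike n).
have hb : h b = fset0 by have [] := gP fset0.
have hx n : h (x n) = spike n by have [] := gP (spike n).
have in_hI k u v : u \in S -> v \in S ->
    (k \in h (u `&` v)%O) = (k \in h u) && (k \in h v).
  by move=> uS vS; rewrite hI // in_fsetI.
have in_hU k u v : u \in S -> v \in S ->
    (k \in h (u `|` v)%O) = (k \in h u) || (k \in h v).
  by move=> uS vS; rewrite hU // in_fsetU.
have wS n : partial_join x b n \in S by elim: n => //= n IHn; apply: SU.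
have xwS n : (x n `&` partial_join x b n)%O \in S by apply: SI.
have cS n : cumulated_meet x b n \in S by elim: n => //= n IHn; apply: SU.
have yS n : spiked x b n \in S by apply: SU.
have hw n k : k \in h (partial_join x b n) -> k < n.*2.
  elim: n => /= [|n IHn]; first by rewrite hb in_fset0.
  by rewrite in_hU // hx in_spike => /orP[/IHn|]; lia.
have hc n k : k \in h (cumulated_meet x b n) -> (k < n.*2) && ~~ odd k.
  elim: n => /= [|n IHn]; first by rewrite hb in_fset0.
  rewrite in_hU // in_hI // hx in_spike => /orP[/IHn|/andP[xk /hw]]; lia.
(* The cumulated meets only contribute even numbers below [2n], which the spike contains already. *)
have hy n k : (k \in h (spiked x b n)) = (k \in spike n).
  rewrite in_hU // hx; case: (boolP (k \in h (cumulated_meet x b n))).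
    by move=> /hc; rewrite in_spike; lia.
  by rewrite orbF.
(* As [h] is controlled on [S] only, the ideal is generated in [T] by the elements of [S] whose
   image omits [k]. *)
pose J k u := exists v, [/\ v \in S, (u <= v)%O & k \notin h v].
have Jideal k : ideal (J k).
  split=> [u v [u' [uS uu' ku]] [v' [vS vv' kv]]|u v uv [v' [vS vv' kv]]].
    exists (u' `|` v')%O; rewrite in_hU // negb_or ku kv.
    by split=> //; [apply: SU | apply: leU2].
  by exists v'; split=> //; apply: le_trans vv'.
have Jb k : J k b by exists b; rewrite hb in_fset0.
have JS k u : u \in S -> J k u <-> k \notin h u.
  move=> uS; split=> [[v [vS /meet_idPl uv kv]]|ku]; last by exists u.
  by apply: contra kv; rewrite -[in X in X -> _]uv in_hI // => /andP[].
split=> [i|i j k ijk|i|i].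
- exact: bot_spiked.
- exact: spiked_meet.
- exists (J i.*2); split=> // [k ki|j ij].
    by apply/(JS _ _ (yS _)); rewrite hy in_spike; lia.
  by move/(JS _ _ (SI _ _ (yS _) (yS _))); rewrite in_hI // !hy !in_spike; lia.
- exists (J i.*2.+1); split=> // [k ki|].
    by apply/(JS _ _ (yS _)); rewrite hy in_spike; lia.
  by move/(JS _ _ (yS _)); rewrite hy in_spike; lia.
Qed.

(** * Infinite antichains in [Gamma] and [Delta], and the equivalence *)

Fact lt_omega_None i : lt_omega (Some i) None.
Proof. by []. Qed.

Definition Delta_omega i : Delta := exist _ (i, None) (lt_omega_None i).

Fact Gamma_omega_subproof i : Gamma_pred (Delta_omega i).
Proof. by []. Qed.

Definition Gamma_omega i : Gamma :=
  exist _ (Delta_omega i) (Gamma_omega_subproof i).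

Lemma Delta_omega_anti i j : (Delta_omega i <= Delta_omega j)%O -> i = j.
Proof. by rewrite le_DeltaE /le_Delta /= andbT => /eqP. Qed.

Theorem mainTheorem10 (d : Order.disp_t) (T : distrLatticeType d) :
  [<-> contains_subposet {fset nat} T;
       quotient_of_sublattice {fset nat} T;
       contains_sublattice (finSeg Gamma) T \/
       contains_sublattice (finSeg Delta) T].
Proof.
tfae.
- by move=> [_ [f [_ fmono]]]; apply: fset_quotient fmono.
- move=> /quotient_staircase[b [y yst]].
  have [n nmono [strict|const]] := staircase_dichotomy yst.
    by right; apply: staircase_Delta (staircase_subseq yst nmono) strict.
  by left; apply: staircase_Gamma (staircase_subseq yst nmono) const.
- case; apply: contains_subposet_sublattice.
    by apply: (@antichain_finSeg _ _ Gamma_omega) => i j /Delta_omega_anti.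
  exact: (@antichain_finSeg _ _ Delta_omega) Delta_omega_anti.
Qed.
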